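(* Let $M_j$ be a merging neighborhood, let $U^*$ be arbitrary cell data, let $s_j\in[0,1]$ be arbitrary, and let $U^{n+1}=R_j(s_j)U^*$ with $R_j(s_j)=(1-s_j)\,\mathrm{Id}+s_j\,S_j$, where $S_j$ is the state redistribution operator on $M_j$. Then $$\sum_{i\in M_j}V_i\,U_i^{n+1}=\sum_{i\in M_j}V_i\,U_i^* .$$
   Context: A domain is divided into finitely many cells $I_i$ with volumes $V_i>0$; cell data is a family $U=(U_i)$ with values in $\mathbb{R}^m$. Small cut cells are grouped into pairwise disjoint merging neighborhoods $M_j$ (nonempty finite sets of cell indices). For each cell $i$, $W_i$ is the set of neighborhood indices $k$ such that cell $i$ receives a contribution from $M_k$, and $w_{i,k}\ge 0$ are weights with $\sum_{k\in W_i}w_{i,k}=1$. Since the neighborhoods are disjoint, $W_i=\{j\}$ for every $i\in M_j$, so $w_{i,j}=1$. The weighted neighborhood volume is $\hat V_j=\sum_{i\in M_j}w_{i,j}V_i$ and the neighborhood average is $\hat Q_j^*=\frac{1}{\hat V_j}\sum_{i\in M_j}w_{i,j}V_iU_i^*$. The state redistribution operator is $[S_jU^*]_i=\sum_{k\in W_i}w_{i,k}\hat Q_k^*$ for $i\in M_j$, and $[S_jU^*]_i=U_i^*$ for $i\notin M_j$. $\mathrm{Id}$ is the identity operator. *)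

(* Defs.v *)
From mathcomp Require Import all_boot all_order all_algebra.

Set Implicit Arguments.
Unset Strict Implicit.
Unset Printing Implicit Defensive.

Import Order.TTheory GRing.Theory Num.Theory.
Local Open Scope ring_scope.

(* [I] indexes the cells and [J] the merging neighborhoods; [V i] is the volume
   of cell [i], [M k] the set of cells merged in the [k]-th neighborhood. *)
Section StateRedistribution.

Variables (R : realFieldType) (m : nat) (I J : finType).
Variables (V : I -> R) (M : J -> {set I}) (w : I -> J -> R).

(* A cell receives a contribution from exactly the neighborhoods it belongs to.
   No disjointness is built in, so [W i] being a singleton for [i] in some
   neighborhood is a consequence of disjointness. *)
Definition W (i : I) : {set J} := [set k | i \in M k].

Definition weighted_volume (k : J) : R := \sum_(i in M k) w i k * V i.

Definition neighborhood_average (U : {ffun I -> 'rV[R]_m}) (k : J) : 'rV[R]_m :=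
  (weighted_volume k)^-1 *: \sum_(i in M k) (w i k * V i) *: U i.

Definition state_redistribution (j : J) (U : {ffun I -> 'rV[R]_m}) :
    {ffun I -> 'rV[R]_m} :=
  [ffun i => if i \in M j
             then \sum_(k in W i) w i k *: neighborhood_average U k
             else U i].

Definition relaxed_redistribution (j : J) (s : R) (U : {ffun I -> 'rV[R]_m}) :
    {ffun I -> 'rV[R]_m} :=
  (1 - s) *: U + s *: state_redistribution j U.

End StateRedistribution.

(* Main.v *)
Require Import Defs.
From mathcomp Require Import all_boot all_order all_algebra.

Set Implicit Arguments.
Unset Strict Implicit.
Unset Printing Implicit Defensive.

Import Order.TTheory GRing.Theory Num.Theory.
Local Open Scope ring_scope.

(** Disjointness forces a cell of [M j] to lie in no other neighborhood, so its
    single weight is [1] ([weight_eq1]).  Redistribution on [M j] then replaces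
    every value there by the one volume-weighted mean of [U] over [M j]
    ([state_redistributionE]), and a mean is characterized by having the same
    total ([state_redistribution_conservative]); its denominator is nonzero
    because [M j] is nonempty and volumes are positive.  The relaxed operator
    combines the identity and redistribution with coefficients [1 - s] and [s],
    which sum to [1]; both give the same total, hence so does it. *)

Section DisjointNeighborhoods.

Variables (R : realFieldType) (m : nat) (I J : finType).
Variables (V : I -> R) (M : J -> {set I}) (w : I -> J -> R).
Hypothesis M_disjoint : forall k l, k != l -> [disjoint M k & M l].

Lemma W_disjoint i j : i \in M j -> W M i = [set j].
Proof.
move=> iMj; apply/setP=> k; rewrite !inE.
have [->|nkj] := eqVneq k j; first by rewrite iMj.
by apply/negbTE; rewrite (disjointFl (M_disjoint nkj) iMj).
Qed.

Hypothesis w_sum1 : forall i, W M i != set0 -> \sum_(k in W M i) w i k = 1.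

(** The sum normalizing the weights of cell [i] has the single term [w i j]. *)
Lemma weight_eq1 i j : i \in M j -> w i j = 1.
Proof.
move=> iMj; have Wi := W_disjoint iMj.
have := w_sum1 (i := i); rewrite Wi big_set1; apply.
by apply/set0Pn; exists j; rewrite inE.
Qed.

Lemma weighted_volumeE j : weighted_volume V M w j = \sum_(i in M j) V i.
Proof. by apply: eq_bigr => i iMj; rewrite weight_eq1 ?mul1r. Qed.

Lemma neighborhood_averageE (U : {ffun I -> 'rV[R]_m}) j :
  neighborhood_average V M w U j =
    (\sum_(i in M j) V i)^-1 *: \sum_(i in M j) V i *: U i.
Proof.
rewrite /neighborhood_average weighted_volumeE; congr (_ *: _).
by apply: eq_bigr => i iMj; rewrite weight_eq1 ?mul1r.
Qed.

Lemma state_redistributionE (U : {ffun I -> 'rV[R]_m}) i j : i \in M j ->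
  state_redistribution V M w j U i = neighborhood_average V M w U j.
Proof.
by move=> iMj; rewrite ffunE iMj (W_disjoint iMj) big_set1 weight_eq1 ?scale1r.
Qed.

(** The redistributed data are constant on [M j], so their total is the volume
    of [M j] times the mean, and that volume cancels the mean's denominator. *)
Lemma state_redistribution_conservative (U : {ffun I -> 'rV[R]_m}) j :
    \sum_(i in M j) V i != 0 ->
  \sum_(i in M j) V i *: state_redistribution V M w j U i =
    \sum_(i in M j) V i *: U i.
Proof.
move=> vol_neq0.
under eq_bigr => i iMj do rewrite state_redistributionE //.
by rewrite -scaler_suml neighborhood_averageE scalerA mulfV ?scale1r.
Qed.

End DisjointNeighborhoods.

Lemma sumr_gt0_set (R : realFieldType) (I : finType) (A : {set I}) (V : I -> R) :
  A != set0 -> (forall i, 0 < V i) -> 0 < \sum_(i in A) V i.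
Proof.
case/set0Pn=> i iA V_gt0; rewrite (bigD1 i) //=.
by apply: ltr_wpDr => //; apply: sumr_ge0 => k _; apply: ltW.
Qed.

Theorem proposition1 (R : realFieldType) (m : nat) (I J : finType)
    (V : I -> R) (M : J -> {set I}) (w : I -> J -> R)
    (V_gt0 : forall i, 0 < V i)
    (M_neq0 : forall k, M k != set0)
    (M_disjoint : forall k l, k != l -> [disjoint M k & M l])
    (w_ge0 : forall i k, k \in W M i -> 0 <= w i k)
    (w_sum1 : forall i, W M i != set0 -> \sum_(k in W M i) w i k = 1)
    (j : J) (Ustar Unext : {ffun I -> 'rV[R]_m}) (s : R)
    (s_itv : 0 <= s <= 1)
    (Unext_def : Unext = relaxed_redistribution V M w j s Ustar) :
  \sum_(i in M j) V i *: Unext i = \sum_(i in M j) V i *: Ustar i.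
Proof.
have vol_neq0 : \sum_(i in M j) V i != 0 by rewrite gt_eqF ?sumr_gt0_set.
have consS := state_redistribution_conservative M_disjoint w_sum1 Ustar vol_neq0.
rewrite Unext_def.
transitivity ((1 - s) *: (\sum_(i in M j) V i *: Ustar i)
    + s *: (\sum_(i in M j) V i *: state_redistribution V M w j Ustar i)).
  rewrite !scaler_sumr -big_split /=; apply: eq_bigr => i _.
  by rewrite !ffunE scalerDr !scalerA ![V i * _]mulrC.
by rewrite consS -scalerDl subrK scale1r.
Qed.
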